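(* Let $n \geq 3$. In the unbiased circle packing game, Builder has a strategy guaranteeing that at some point the contact graph of the current circle packing contains (as a subgraph) an Apollonian network on $n$ vertices.
   Context: A circle packing is a finite set of circles in the plane with pairwise disjoint interiors; its contact graph $\mathbf{G}(\mathcal{C})$ has one vertex per circle, two vertices adjacent iff the circles are (externally) tangent. In the unbiased circle packing game, Builder and Spoiler alternately place one circle each in the plane such that the set of all placed circles is always a circle packing. Apollonian networks are defined recursively: $K_3$ is an Apollonian network; if $G$ is an Apollonian network (with a fixed plane drawing), $F$ is a face of $G$, and one adds a new vertex inside $F$ joined to the three vertices incident to $F$, the result is an Apollonian network. *)

(* Defs.v *)
From mathcomp Require Import all_boot all_order all_algebra.
From mathcomp Require Import boolp classical_sets reals.

Set Implicit Arguments.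
Unset Strict Implicit.
Unset Printing Implicit Defensive.

Import Order.TTheory GRing.Theory Num.Theory.
Local Open Scope ring_scope.
Local Open Scope classical_set_scope.

(* The library norm on [R * R] is the sup norm, hence an explicit distance. *)
Definition edist (R : realType) (p q : R * R) : R :=
  Num.sqrt ((p.1 - q.1) ^+ 2 + (p.2 - q.2) ^+ 2).

Record circle (R : realType) := Circle {
  center : R * R;
  radius : R;
  radius_gt0 : 0 < radius }.

Definition circle_points (R : realType) (C : circle R) : set (R * R) :=
  [set p | edist (center C) p = radius C].

Definition circle_interior (R : realType) (C : circle R) : set (R * R) :=
  [set p | edist (center C) p < radius C].

Definition disjoint_interiors (R : realType) (C D : circle R) : Prop :=
  circle_interior C `&` circle_interior D = set0.

Definition ext_tangent (R : realType) (C D : circle R) : Prop :=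
  disjoint_interiors C D /\
  exists p : R * R, circle_points C `&` circle_points D = [set p].

(* A packing is listed in the order in which its circles are placed.  The
   condition ranges over pairs of positions and interiors are nonempty, so no
   circle occurs twice. *)
Definition packing (R : realType) (s : seq (circle R)) : Prop :=
  forall i j : 'I_(size s), i != j ->
    disjoint_interiors (tnth (in_tuple s) i) (tnth (in_tuple s) j).

Definition contact_graph (R : realType) (s : seq (circle R)) :
    rel 'I_(size s) :=
  fun i j => `[< ext_tangent (tnth (in_tuple s) i) (tnth (in_tuple s) j) >].

Definition is_subgraph (V W : finType) (e : rel V) (e' : rel W) : Prop :=
  exists f : V -> W, injective f /\ forall u v, e u v -> e' (f u) (f v).

(* The graph [e] with a new vertex [None] joined to [a], [b] and [c]. *)
Definition stack_rel (V : finType) (e : rel V) (a b c : V) : rel (option V) :=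
  fun x y => match x, y with
  | Some u, Some v => e u v
  | Some u, None | None, Some u => u \in [:: a; b; c]
  | None, None => false
  end.

Definition lift_face (V : Type) (t : V * V * V) :
    option V * option V * option V :=
  (Some t.1.1, Some t.1.2, Some t.2).

(* [drawn_apollonian e F]: [e] is the edge relation of an Apollonian network
   and [F] lists the faces, the unbounded one included, of a plane drawing of
   it.  All faces are bounded by triangles; each is given by its boundary
   cycle, oriented with the face on the left, so that the two faces of a drawing
   of K_3 are told apart.  A vertex drawn inside the face [(a, b, c)] and
   joined to [a], [b], [c] divides this face into three. *)
Inductive drawn_apollonian :
    forall V : finType, rel V -> seq (V * V * V) -> Prop :=
| drawn_K3 (V : finType) (a b c : V) :
    #|V| = 3%N -> uniq [:: a; b; c] ->
    drawn_apollonian (fun x y : V => x != y) [:: (a, b, c); (a, c, b)]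
| drawn_stack (V : finType) (e : rel V) (F : seq (V * V * V)) (a b c : V) :
    drawn_apollonian e F -> (a, b, c) \in F ->
    drawn_apollonian (stack_rel e a b c)
      [:: (Some a, Some b, None), (Some b, Some c, None),
          (Some c, Some a, None)
        & [seq lift_face t | t <- rem (a, b, c) F]].

Definition apollonian_network (V : finType) (e : rel V) : Prop :=
  exists F : seq (V * V * V), drawn_apollonian e F.

Definition contains_apollonian (R : realType) (n : nat)
    (s : seq (circle R)) : Prop :=
  exists (V : finType) (e : rel V),
    [/\ #|V| = n, apollonian_network e & is_subgraph e (@contact_graph R s)].

(* Builder moves first, hence exactly when an even number of circles has been
   placed.  A strategy sends the circles placed so far to Builder's next one. *)
Definition builder_strategy (R : realType)
    (sigma : seq (circle R) -> circle R) : Prop :=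
  forall s, ~~ odd (size s) -> packing s -> packing (rcons s (sigma s)).

(* [x k] is the circle placed at move [k] (from 0); odd moves are Spoiler's. *)
Definition play_following (R : realType)
    (sigma : seq (circle R) -> circle R) (x : nat -> circle R) : Prop :=
  (forall m, packing (mkseq x m)) /\
  (forall k, x k.*2 = sigma (mkseq x k.*2)).

(* Main.v *)
Require Import Defs.
From mathcomp Require Import all_boot all_order all_algebra.
From mathcomp Require Import boolp classical_sets reals.
From mathcomp Require Import ring lra.

(** The inversive product P(C, D) = (d^2 - r^2 - r'^2) / (2 r r') is at least 1 iff
    the interiors are disjoint, is 1 iff the circles are externally tangent, and
    is a Lorentzian bilinear form in suitable coordinates.  If A, B, C, O are
    mutually tangent, then D = 2 (A + B + C) - O is the other circle tangent to
    A, B, C; a circle u outside the interstice of A, B, C opposite to O satisfies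
    P(u, O) <= P(u, A) + P(u, B) + P(u, C), so that P(u, D) >= 1.  For a circle
    disjoint from four mutually tangent circles, two of the four inequalities of
    this kind cannot fail together (add them).  Hence one move of Spoiler never
    spoils two interstices, while each circle put into a free interstice leaves
    three of them.  To get started, Builder makes two unit circles tangent and
    then places a circle so deep in the cusp between them that neither of its
    neighbours in the chain of tangent circles is met by the earlier circles;
    Spoiler blocks at most one of the two neighbours. *)

Set Implicit Arguments.
Unset Strict Implicit.
Unset Printing Implicit Defensive.

Import Order.TTheory GRing.Theory Num.Theory.
Local Open Scope ring_scope.
Local Open Scope classical_set_scope.

Section Circles.
Variable R : realType.
Implicit Types (A B C D O t u : circle R) (p q : R * R) (s : seq (circle R)).

(** * Inversive product and tangency *)

Definition sqdist p q : R := (p.1 - q.1) ^+ 2 + (p.2 - q.2) ^+ 2.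

Definition curv C : R := (radius C)^-1.

Definition inv_prod C D : R :=
  (sqdist (center C) (center D) - radius C ^+ 2 - radius D ^+ 2) /
  (2 * radius C * radius D).

Lemma sqdist_ge0 p q : 0 <= sqdist p q.
Proof. by rewrite addr_ge0 ?sqr_ge0. Qed.

Lemma sqdist_eq0 p q : sqdist p q <= 0 -> p = q.
Proof.
case: p q => [p1 p2] [q1 q2]; rewrite /sqdist /= => h.
have h1 := sqr_ge0 (p1 - q1); have h2 := sqr_ge0 (p2 - q2).
have /eqP : (p1 - q1) ^+ 2 = 0 by lra.
have /eqP : (p2 - q2) ^+ 2 = 0 by lra.
by rewrite !sqrf_eq0 !subr_eq0 => /eqP -> /eqP ->.
Qed.

Lemma edist_lt p q (r : R) : 0 < r -> (edist p q < r) = (sqdist p q < r ^+ 2).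
Proof.
move=> r0; rewrite /edist -/(sqdist p q).
by rewrite -(ltr_sqrt _ (exprn_gt0 2 r0)) sqrtr_sqr gtr0_norm.
Qed.

Lemma edist_eq p q (r : R) : 0 < r -> edist p q = r <-> sqdist p q = r ^+ 2.
Proof.
move=> r0; split=> [<-|h]; first by rewrite /edist sqr_sqrtr ?sqdist_ge0.
by rewrite /edist -/(sqdist p q) h sqrtr_sqr gtr0_norm.
Qed.

(* The point dividing the segment of centers in the ratio of the radii; it is
   the point of contact when the circles are tangent. *)
Definition contact C D : R * R :=
  let: (r, r') := (radius C, radius D) in
  ((r' * (center C).1 + r * (center D).1) / (r + r'),
   (r' * (center C).2 + r * (center D).2) / (r + r')).

Lemma sqdist_contactl C D : sqdist (center C) (contact C D) =
  sqdist (center C) (center D) * (radius C / (radius C + radius D)) ^+ 2.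
Proof.
have := radius_gt0 C; have := radius_gt0 D; rewrite /contact /sqdist /=.
by move=> h1 h2; field; lra.
Qed.

Lemma sqdist_contactr C D : sqdist (center D) (contact C D) =
  sqdist (center C) (center D) * (radius D / (radius C + radius D)) ^+ 2.
Proof.
have := radius_gt0 C; have := radius_gt0 D; rewrite /contact /sqdist /=.
by move=> h1 h2; field; lra.
Qed.

(** Stewart's theorem for the contact point on the segment of centers. *)
Lemma stewart C D p :
  (radius C + radius D) * sqdist p (contact C D) =
  radius D * sqdist (center C) p + radius C * sqdist (center D) p -
  radius C * radius D / (radius C + radius D)
    * sqdist (center C) (center D).
Proof.
have := radius_gt0 C; have := radius_gt0 D; rewrite /contact /sqdist /=.
by move=> h1 h2; field; lra.
Qed.

Lemma inv_prodC C D : inv_prod C D = inv_prod D C.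
Proof.
have := radius_gt0 C; have := radius_gt0 D; rewrite /inv_prod /sqdist.
by move=> h1 h2; field; lra.
Qed.

Lemma inv_prod_self C : inv_prod C C = -1.
Proof.
by have := radius_gt0 C; rewrite /inv_prod /sqdist => h; field; lra.
Qed.

Lemma inv_prodE C D : sqdist (center C) (center D) =
  (radius C + radius D) ^+ 2 + 2 * radius C * radius D * (inv_prod C D - 1).
Proof.
have := radius_gt0 C; have := radius_gt0 D; rewrite /inv_prod /sqdist.
by move=> h1 h2; field; lra.
Qed.

(** If the product is below 1, [contact C D] lies in both interiors. Otherwise a common interior
    point would make the left side of [stewart] negative. *)
Lemma disjoint_interiorsP C D :
  disjoint_interiors C D <-> 1 <= inv_prod C D.
Proof.
have c0 := radius_gt0 C; have d0 := radius_gt0 D.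
have cd0 : 0 < radius C * radius D by rewrite mulr_gt0.
have sum0 : 0 < radius C + radius D by rewrite addr_gt0.
split=> [disj|h].
  rewrite leNgt; apply/negP => lt1.
  have lt_sq : sqdist (center C) (center D) < (radius C + radius D) ^+ 2.
    by rewrite inv_prodE; nra.
  suff : (circle_interior C `&` circle_interior D) (contact C D).
    by rewrite disj.
  split; rewrite /circle_interior /= edist_lt //.
    rewrite sqdist_contactl expr_div_n mulrA ltr_pdivrMr ?exprn_gt0 //.
    by rewrite mulrC ltr_pM2l ?exprn_gt0.
  rewrite sqdist_contactr expr_div_n mulrA ltr_pdivrMr ?exprn_gt0 //.
  by rewrite mulrC ltr_pM2l ?exprn_gt0.
apply/seteqP; split=> // p []; rewrite /circle_interior /= !edist_lt // => hC hD.
have := stewart C D p; have := sqdist_ge0 p (contact C D).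
rewrite inv_prodE; set x := sqdist p _; set y := sqdist _ p in hC *.
set z := sqdist _ p in hD *; set a := radius C in c0 hC cd0 sum0 *.
set b := radius D in d0 hD cd0 sum0 * => x0.
have -> : a * b / (a + b) * ((a + b) ^+ 2 + 2 * a * b * (inv_prod C D - 1)) =
  a * b * (a + b) + 2 * (a * b) ^+ 2 / (a + b) * (inv_prod C D - 1).
  by field; lra.
have : 0 <= 2 * (a * b) ^+ 2 / (a + b) * (inv_prod C D - 1).
  by rewrite mulr_ge0 ?subr_ge0 // divr_ge0 ?ltW // mulr_gt0 ?exprn_gt0.
by nra.
Qed.

Lemma inv_prod1_ext_tangent C D : inv_prod C D = 1 -> ext_tangent C D.
Proof.
move=> h; split; first by apply/disjoint_interiorsP; rewrite h.
have c0 := radius_gt0 C; have d0 := radius_gt0 D.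
have sum0 : radius C + radius D != 0 by apply/lt0r_neq0/addr_gt0.
have dist : sqdist (center C) (center D) = (radius C + radius D) ^+ 2.
  by rewrite inv_prodE h; ring.
exists (contact C D); apply/seteqP; split=> [p []|_ ->].
  rewrite /circle_points /= => /(edist_eq _ _ c0) hC /(edist_eq _ _ d0) hD.
  apply: sqdist_eq0; have := stewart C D p; rewrite hC hD dist.
  set x := sqdist p _ => e.
  have : (radius C + radius D) * x = 0 by rewrite e; field.
  by move/eqP; rewrite mulf_eq0 (negPf sum0) => /eqP ->.
split; rewrite /circle_points /=; apply/edist_eq => //.
  by rewrite sqdist_contactl dist -exprMn mulrCA divff // mulr1.
by rewrite sqdist_contactr dist -exprMn mulrCA divff // mulr1.
Qed.

(** * Lorentzian coordinates and Descartes' theorem *)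

Definition lorentz (k x y m k' x' y' m' : R) : R :=
  (k * m' + k' * m) / 2 - x * x' - y * y'.

(** The signed curvature of the image of [C] under inversion in the unit circle about the origin. *)
Definition cocurv C : R := curv C * sqdist (center C) (0, 0) - radius C.

Lemma inv_prod_lorentz C D : inv_prod C D =
  lorentz (curv C) (curv C * (center C).1) (curv C * (center C).2) (cocurv C)
    (curv D) (curv D * (center D).1) (curv D * (center D).2) (cocurv D).
Proof.
have := radius_gt0 C; have := radius_gt0 D.
rewrite /inv_prod /lorentz /cocurv /curv /sqdist /= => h1 h2.
by field; lra.
Qed.

Lemma curv_gt0 C : 0 < curv C.
Proof. by rewrite invr_gt0 radius_gt0. Qed.

(** The norm condition determines [m] from the other coordinates, so the circle with center (x / k,
    y / k) and radius 1 / k has the given coordinates. *)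
Lemma circle_of_lorentz (k x y m : R) :
  0 < k -> lorentz k x y m k x y m = -1 ->
  exists C, [/\ curv C = k, curv C * (center C).2 = y & forall u, inv_prod u C =
    lorentz (curv u) (curv u * (center u).1) (curv u * (center u).2) (cocurv u)
      k x y m].
Proof.
move=> k0 hN; have r0 : 0 < k^-1 by rewrite invr_gt0.
exists (Circle (x / k, y / k) r0); rewrite /curv /= invrK; split=> // [|u].
  by rewrite mulrC divfK ?gt_eqF.
rewrite inv_prod_lorentz /cocurv /curv /sqdist /= invrK.
have -> : m = (x ^+ 2 + y ^+ 2 - 1) / k.
  move: hN; rewrite /lorentz => hN.
  have -> : x ^+ 2 + y ^+ 2 - 1 = m * k by lra.
  by field; lra.
have := radius_gt0 u.
by move=> ?; rewrite /lorentz; field; lra.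
Qed.

Definition tangent3 A B C : Prop :=
  [/\ inv_prod A B = 1, inv_prod B C = 1 & inv_prod C A = 1].

Definition tangent_to3 D A B C : Prop :=
  [/\ inv_prod A D = 1, inv_prod B D = 1 & inv_prod C D = 1].

(* In inversive coordinates the two circles tangent to A, B and C add up to
   2 (A + B + C) (Descartes' theorem). *)
Lemma soddy_conjugate A B C O :
  tangent3 A B C -> tangent_to3 O A B C -> curv O <= curv A + curv B + curv C ->
  exists D, curv D = 2 * (curv A + curv B + curv C) - curv O /\
    forall u, inv_prod u D =
      2 * (inv_prod u A + inv_prod u B + inv_prod u C) - inv_prod u O.
Proof.
move=> [hAB hBC hCA] [hAO hBO hCO] hk.
have hA := inv_prod_self A; have hB := inv_prod_self B.
have hC := inv_prod_self C; have hO := inv_prod_self O.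
have kA := curv_gt0 A; have kB := curv_gt0 B; have kC := curv_gt0 C.
pose comb (f : circle R -> R) : R := 2 * (f A + f B + f C) - f O.
have [| | D [kD _ hD]] := @circle_of_lorentz (comb curv)
  (comb (fun X => curv X * (center X).1)) (comb (fun X => curv X * (center X).2))
  (comb cocurv).
- by rewrite /comb; lra.
- move: hAB hBC hCA hAO hBO hCO hA hB hC hO.
  rewrite !inv_prod_lorentz /lorentz /comb; lra.
exists D; split=> // u; rewrite hD !inv_prod_lorentz /lorentz /comb; ring.
Qed.

(** * Packings, and strategies from invariants *)

Definition unit_circle p : circle R := @Circle R p 1 ltr01.

Local Notation "s .[ i ]" := (nth (unit_circle (0, 0)) s i).

Lemma packingP s : packing s <-> forall i j, (i < size s)%N -> (j < size s)%N ->
  i != j -> 1 <= inv_prod s.[i] s.[j].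
Proof.
split=> [h i j hi hj ij | h i j ij].
  have := h (Ordinal hi) (Ordinal hj) ij.
  by rewrite !(tnth_nth (unit_circle (0, 0))) /= => /disjoint_interiorsP.
rewrite !(tnth_nth (unit_circle (0, 0))) /=.
by apply/disjoint_interiorsP/h.
Qed.

Lemma packing_rcons s C : packing (rcons s C) <->
  packing s /\ forall i, (i < size s)%N -> 1 <= inv_prod s.[i] C.
Proof.
rewrite !packingP size_rcons; split=> [h|[h hC] i j].
  split=> [i j hi hj ij | i hi].
    by have := h i j (ltnW hi) (ltnW hj) ij; rewrite !nth_rcons hi hj.
  have := h i (size s) (ltnW hi) (ltnSn _).
  by rewrite !nth_rcons hi ltnn eqxx; apply; rewrite neq_ltn hi.
rewrite !ltnS !nth_rcons (leq_eqVlt i) (leq_eqVlt j).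
case/predU1P=> [->|hi]; case/predU1P=> [->|hj]; rewrite ?ltnn ?eqxx ?hi ?hj //.
- by rewrite inv_prodC => _; apply: hC.
- by move=> _; apply: hC.
- exact: h.
Qed.

Lemma eventually_bounded (n : nat) (Q : nat -> R -> Prop) :
  (forall i, (i < n)%N -> exists W, forall w, W <= w -> Q i w) ->
  exists W, forall w, W <= w -> forall i, (i < n)%N -> Q i w.
Proof.
elim: n => [|n IH] h; first by exists 0.
have [W1 h1] := IH (fun i hi => h i (ltnW hi)).
have [W2 h2] := h n (ltnSn n).
exists (Num.max W1 W2) => w; rewrite ge_max => /andP[le1 le2] i.
rewrite ltnS leq_eqVlt => /predU1P[->|hi]; [exact: h2 | exact: h1].
Qed.

(** A unit circle far enough to the right avoids any finite packing. *)
Lemma packing_extend s : packing s -> exists C, packing (rcons s C).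
Proof.
move=> ps.
have [i hi|W hW] := @eventually_bounded (size s)
  (fun i w => 1 <= inv_prod s.[i] (unit_circle (w, 0))).
  set u := s.[i]; exists ((center u).1 + radius u + 1) => w hw.
  have r0 := radius_gt0 u; have y0 := sqr_ge0 ((center u).2 - 0).
  rewrite /inv_prod /sqdist /= ler_pdivlMr ?mulr_gt0 //.
  by nra.
by exists (unit_circle (W, 0)); apply/packing_rcons; split=> // i; apply: hW.
Qed.

Lemma strategy_of_invariant (I : seq (circle R) -> Prop) :
  I [::] ->
  (forall s, packing s -> I s -> exists C, packing (rcons s C) /\
     forall t, packing (rcons (rcons s C) t) -> I (rcons (rcons s C) t)) ->
  exists sigma, builder_strategy sigma /\ forall x, play_following sigma x ->
    forall k, I (mkseq x k.*2).
Proof.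
move=> I0 step.
(* Choice asks for an answer to every [s]: any circle if [s] is not a packing, any legal move if it
   is one but [I] fails. *)
have /choice [sigma h] s : exists C, packing s -> packing (rcons s C) /\ (I s ->
    forall t, packing (rcons (rcons s C) t) -> I (rcons (rcons s C) t)).
  have [ps|nps] := pselect (packing s); last by exists (unit_circle (0, 0)).
  have [Is|nIs] := pselect (I s).
    by have [C [? ?]] := step s ps Is; exists C.
  by have [C ?] := packing_extend ps; exists C.
exists sigma; split=> [s _ ps|x [px hx]]; first by case: (h s ps).
elim=> [|k IH] //; rewrite doubleS !mkseqS hx.
have [_] := h _ (px k.*2); apply=> //.
by rewrite -hx -!mkseqS.
Qed.

(** * Filling interstices *)

Definition network_in (j : nat) s (V : finType) (e : rel V)
    (F : seq (V * V * V)) (g : V -> nat) : Prop :=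
  [/\ #|V| = j, drawn_apollonian e F, injective g,
      (forall v, g v < size s)%N &
      forall v w, e v w -> inv_prod s.[g v] s.[g w] = 1].

(** Once D is placed, the last two inequalities keep the interstices beside D and opposite to A and
    to B free of the circles of [s]. *)
Definition fits s A B D : Prop :=
  forall i, (i < size s)%N -> [/\ 1 <= inv_prod s.[i] D,
    inv_prod s.[i] A <= inv_prod s.[i] D & inv_prod s.[i] B <= inv_prod s.[i] D].

(** D is Builder's next move. The curvatures are compared because [curv] acts as the product with
    the point at infinity. D is compared with two circles only: in [third_circle_step] it may be
    larger than the third. *)
Definition fillable (j : nat) s : Prop :=
  exists (V : finType) (e : rel V) (F : seq (V * V * V)) (g : V -> nat)
    (a b c : V) (D : circle R),
  [/\ network_in j s e F g /\ (a, b, c) \in F,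
      tangent3 s.[g a] s.[g b] s.[g c], tangent_to3 D s.[g a] s.[g b] s.[g c],
      curv s.[g a] <= curv D /\ curv s.[g b] <= curv D &
      fits s s.[g a] s.[g b] D].

(* No circle of [s], and not the point at infinity either, lies in the
   interstice of A, B, C away from O. *)
Definition free_face s A B C O : Prop :=
  curv O <= curv A + curv B + curv C /\
  forall i, (i < size s)%N ->
    inv_prod s.[i] O <= inv_prod s.[i] A + inv_prod s.[i] B + inv_prod s.[i] C.

(** For D conjugate to O, [free_face] gives P(u, D) >= P(u, A) + P(u, B) + P(u, C), with all terms
    at least 1 unless u is A, B or C; these three cases are computed directly. *)
Lemma free_face_fillable (j : nat) s (V : finType) (e : rel V)
    (F : seq (V * V * V)) (g : V -> nat) (a b c : V) O :
  packing s -> network_in j s e F g -> (a, b, c) \in F ->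
  tangent3 s.[g a] s.[g b] s.[g c] -> tangent_to3 O s.[g a] s.[g b] s.[g c] ->
  free_face s s.[g a] s.[g b] s.[g c] O -> fillable j s.
Proof.
move=> /packingP ps net abcF tan tanO [kO freeO].
have [D [kD hD]] := soddy_conjugate tan tanO kO.
have [hab hbc hca] := tan; have [haO hbO hcO] := tanO.
have ka := curv_gt0 s.[g a]; have kb := curv_gt0 s.[g b].
have kc := curv_gt0 s.[g c].
have haa := inv_prod_self s.[g a]; have hbb := inv_prod_self s.[g b].
have hcc := inv_prod_self s.[g c].
have hba := inv_prodC s.[g b] s.[g a]; have hcb := inv_prodC s.[g c] s.[g b].
have hac := inv_prodC s.[g a] s.[g c].
have [_ _ _ gs _] := net.
exists V, e, F, g, a, b, c, D; split=> //.
- by split; rewrite hD; lra.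
- by rewrite kD; lra.
move=> i hi; rewrite hD.
have [->|ia] := eqVneq i (g a); first by split; lra.
have [->|ib] := eqVneq i (g b); first by split; lra.
have [->|ic] := eqVneq i (g c); first by split; lra.
have := ps i _ hi (gs a) ia; have := ps i _ hi (gs b) ib.
have := ps i _ hi (gs c) ic; have := freeO i hi.
by split; lra.
Qed.

(** Builder plays D. By [fits] the old circles leave the interstices of c, a, D and of b, c, D free,
    and one of these survives Spoiler's reply. *)
Lemma fillable_step (j : nat) s : packing s -> fillable j s ->
  exists C, packing (rcons s C) /\
    forall t, packing (rcons (rcons s C) t) ->
      fillable j.+1 (rcons (rcons s C) t).
Proof.
move=> ps [V [e [F [g [a [b [c [D [[net abcF]]]]]]]]]].
move=> [hab hbc hca] [haD hbD hcD] [kaD kbD] hfit.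
exists D; split.
  by apply/packing_rcons; split=> // i hi; case: (hfit i hi).
move=> t pt; set s2 := rcons _ t in pt *.
have sz2 : size s2 = (size s).+2 by rewrite !size_rcons.
have old i : (i < size s)%N -> s2.[i] = s.[i].
  by move=> hi; rewrite !nth_rcons size_rcons (leqW hi) hi.
have newD : s2.[size s] = D.
  by rewrite !nth_rcons size_rcons ltnSn ltnn eqxx.
have newt : s2.[(size s).+1] = t by rewrite nth_rcons size_rcons ltnn eqxx.
have [cardV drawn ginj gs gtan] := net.
(* D sits at position [size s]; the reply [t], one position later, stays outside the network. *)
pose g' (v : option V) := if v is Some v' then g v' else size s.
have g'S v : s2.[g' (Some v)] = s.[g v] by exact: old (gs v).
have g'N : s2.[g' None] = D by [].
have net' : network_in j.+1 s2 (stack_rel e a b c)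
    [:: (Some a, Some b, None), (Some b, Some c, None), (Some c, Some a, None)
      & [seq lift_face f | f <- rem (a, b, c) F]] g'.
  split; first by rewrite card_option cardV.
  - exact: drawn_stack.
  - case=> [v|] [w|] //= h; first by rewrite (ginj v w).
    + by have := gs v; rewrite h ltnn.
    + by have := gs w; rewrite -h ltnn.
  - by case=> [v|] /=; rewrite sz2 ltnS ?leqnSn // ltnW // ltnS ltnW.
  have tanD v : v \in [:: a; b; c] -> inv_prod s.[g v] D = 1.
    by rewrite !inE => /or3P[] /eqP ->.
  case=> [v|] [w|] //; rewrite ?g'S ?g'N; first exact: gtan.
  - exact: tanD.
  - by rewrite inv_prodC; apply: tanD.
have hbt i : (i < size s2)%N -> i != (size s).+1 ->
    inv_prod s2.[i] s.[g b] <=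
      inv_prod s2.[i] s.[g c] + inv_prod s2.[i] s.[g a] + inv_prod s2.[i] D /\
    inv_prod s2.[i] s.[g a] <=
      inv_prod s2.[i] s.[g b] + inv_prod s2.[i] s.[g c] + inv_prod s2.[i] D.
  rewrite sz2 ltnS leq_eqVlt => /predU1P[->|]; first by rewrite eqxx.
  have haa := inv_prod_self s.[g a]; have hbb := inv_prod_self s.[g b].
  have hcc := inv_prod_self s.[g c]; have hDD := inv_prod_self D.
  have hba := inv_prodC s.[g b] s.[g a]; have hcb := inv_prodC s.[g c] s.[g b].
  have hac := inv_prodC s.[g a] s.[g c]; have hDa := inv_prodC s.[g a] D.
  have hDb := inv_prodC s.[g b] D; have hDc := inv_prodC s.[g c] D.
  rewrite ltnS leq_eqVlt => /predU1P[->|hi] _; first by rewrite newD; lra.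
  rewrite old //; have [] := hfit i hi.
  have [->|ia] := eqVneq i (g a); first by lra.
  have [->|ib] := eqVneq i (g b); first by lra.
  have [->|ic] := eqVneq i (g c); first by lra.
  have /packingP ps' := ps.
  have := ps' i _ hi (gs a) ia; have := ps' i _ hi (gs b) ib.
  have := ps' i _ hi (gs c) ic; lra.
have [_ pt'] := (packing_rcons _ _).1 pt.
rewrite size_rcons in pt'.
have tgt v : 1 <= inv_prod t s.[g v].
  have := pt' (g v) (leqW (gs v)); rewrite nth_rcons gs.
  by rewrite inv_prodC.
have tgD : 1 <= inv_prod t D.
  by have := pt' (size s) (ltnSn _); rewrite nth_rcons ltnn eqxx inv_prodC.
have ta := tgt a; have tb := tgt b; have tc := tgt c.
have ka := curv_gt0 s.[g a]; have kb := curv_gt0 s.[g b].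
have kc := curv_gt0 s.[g c].
(* [t] cannot block both of the interstices of c, a, D and of b, c, D. *)
have [tfree|tblock] := leP (inv_prod t s.[g b])
    (inv_prod t s.[g c] + inv_prod t s.[g a] + inv_prod t D).
  apply: (@free_face_fillable _ _ _ _ _ g' (Some c) (Some a) None s.[g b] pt net').
  - by rewrite !inE eqxx !orbT.
  - by rewrite !g'S g'N; split; rewrite // inv_prodC.
  - by rewrite !g'S g'N; split; rewrite // inv_prodC.
  split; first by rewrite !g'S g'N; lra.
  move=> i hi; rewrite !g'S g'N.
  have [->|it] := eqVneq i (size s).+1; first by rewrite newt.
  by have [] := hbt i hi it.
apply: (@free_face_fillable _ _ _ _ _ g' (Some b) (Some c) None s.[g a] pt net').
- by rewrite !inE eqxx !orbT.
- by rewrite !g'S g'N; split; rewrite // inv_prodC.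
- by rewrite !g'S g'N; split; rewrite // inv_prodC.
split; first by rewrite !g'S g'N; lra.
move=> i hi; rewrite !g'S g'N.
have [->|it] := eqVneq i (size s).+1; first by rewrite newt; lra.
by have [] := hbt i hi it.
Qed.

Lemma fillable_contains (j : nat) s :
  fillable j s -> contains_apollonian j s.
Proof.
move=> [V [e [F [g [a [b [c [D [[[cardV drawn ginj gs gtan] _] _ _ _ _]]]]]]]]].
exists V, e; split=> //; first by exists F.
exists (fun v => Ordinal (gs v)); split=> [v w [] /ginj //|v w evw].
apply/asboolP; rewrite !(tnth_nth (unit_circle (0, 0))) /=.
exact/inv_prod1_ext_tangent/gtan.
Qed.

(** * The first three circles *)

(* The circles tangent to the unit circles about 0 and (2 eps, 0) on one side
   of the line of centers; [w] is curvature times height.  They shrink to the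
   point of contact, and consecutive ones with step 2 are tangent. *)
Lemma tangent_chain (eps : R) : eps ^+ 2 = 1 ->
  exists C : R -> circle R, forall w, 1 < w ->
    [/\ curv (C w) = (w ^+ 2 - 1) / 2, curv (C w) * (center (C w)).2 = w &
    forall u, inv_prod u (C w) =
      (inv_prod u (unit_circle (0, 0)) + inv_prod u (unit_circle (2 * eps, 0)))
        * (w ^+ 2 - 1) / 4 - w * (curv u * (center u).2) + curv u].
Proof.
move=> eps2.
suff /choice [C hC] : forall w, exists D, 1 < w ->
    [/\ curv D = (w ^+ 2 - 1) / 2, curv D * (center D).2 = w &
    forall u, inv_prod u D =
      (inv_prod u (unit_circle (0, 0)) + inv_prod u (unit_circle (2 * eps, 0)))
        * (w ^+ 2 - 1) / 4 - w * (curv u * (center u).2) + curv u].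
  by exists C.
move=> w.
have [w1|] := pselect (1 < w); last by exists (unit_circle (0, 0)).
(* Tangency to the two unit circles means m = k + 2 and x = eps k; with y = w, norm -1 then gives 2
   k = w^2 - 1. *)
have [| | D [kD yD hD]] := @circle_of_lorentz ((w ^+ 2 - 1) / 2)
    (eps * (w ^+ 2 - 1) / 2) w ((w ^+ 2 + 3) / 2).
- by nra.
- rewrite /lorentz.
  have -> : (eps * (w ^+ 2 - 1) / 2) * (eps * (w ^+ 2 - 1) / 2) =
     eps ^+ 2 * ((w ^+ 2 - 1) / 2) ^+ 2 by field.
  by rewrite eps2; field.
exists D => _; split=> // u.
rewrite hD !inv_prod_lorentz /lorentz /cocurv /curv /sqdist /= invr1.
have -> : (2 * eps - 0) ^+ 2 = 4 * eps ^+ 2 by ring.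
rewrite eps2; field.
by rewrite gt_eqF ?radius_gt0.
Qed.

(** For q = P(u, A) + P(u, B) the right side is P(u, D), D being the chain circle of parameter [w].
    The bound q, rather than 1, makes P(u, D) dominate both summands, as [fits] demands. *)
Lemma quadratic_eventually (q b k : R) : 2 <= q ->
  exists W, forall w, W <= w -> q <= q * (w ^+ 2 - 1) / 4 - w * b + k.
Proof.
move=> q2; exists (4 + 4 * `|b| + 2 * `|k|) => w hw.
have := ler_norm b; have := ler_norm (- k); rewrite normrN.
move: (normr_ge0 b) (normr_ge0 k) hw.
move: `|b| `|k| => b' k' b0 k0 hw hk hb.
have wb : w * b <= w * b' by apply: ler_wpM2l => //; lra.
have h1 : 2 * (w ^+ 2 - 5) <= q * (w ^+ 2 - 5).
  by apply: ler_wpM2r => //; nra.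
have h2 : w * (4 + 4 * b' + 2 * k') <= w * w by apply: ler_wpM2l => //; lra.
have h3 : 0 <= w * k' - k' by rewrite -{2}(mul1r k') -mulrBl mulr_ge0; lra.
have h4 : 0 <= w * b' by apply: mulr_ge0; lra.
rewrite expr2 in h1 *; lra.
Qed.

Lemma third_circle_step (s : seq (circle R)) (i j : nat) (eps : R) :
  eps ^+ 2 = 1 -> packing s -> (i < size s)%N -> (j < size s)%N ->
  s.[i] = unit_circle (0, 0) -> s.[j] = unit_circle (2 * eps, 0) ->
  exists C, packing (rcons s C) /\
    forall t, packing (rcons (rcons s C) t) ->
      fillable 3 (rcons (rcons s C) t).
Proof.
move=> eps2 ps hi hj.
set A := unit_circle (0, 0); set B := unit_circle (2 * eps, 0) => sA sB.
have [Ch hCh] := tangent_chain eps2; rewrite -/A -/B in hCh.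
have hAA := inv_prod_self A; have hBB := inv_prod_self B.
have hAB : inv_prod A B = 1.
  rewrite /inv_prod /sqdist /=.
  have -> : (0 - 2 * eps) ^+ 2 = 4 * eps ^+ 2 by ring.
  by rewrite eps2; field.
have hBA : inv_prod B A = 1 by rewrite inv_prodC.
have ij : i != j by apply: contra_eq_neq hAA => E; rewrite -{1}sA E sB hBA; lra.
have ACh w : 1 < w -> inv_prod A (Ch w) = 1.
  by move=> /hCh[_ _ ->]; rewrite hAA hAB /curv /= invr1; ring.
have BCh w : 1 < w -> inv_prod B (Ch w) = 1.
  by move=> /hCh[_ _ ->]; rewrite hBB hBA /curv /= invr1; ring.
(* The product of two chain circles is (w - w')^2 / 2 - 1. *)
have ChCh w w' : 1 < w -> 1 < w' -> (w - w') ^+ 2 = 4 ->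
    inv_prod (Ch w) (Ch w') = 1.
  move=> w1 w1' e; have [kw yw _] := hCh w w1.
  have [_ _ ->] := hCh w' w1'; rewrite ![inv_prod (Ch w) _]inv_prodC.
  rewrite ACh // BCh // yw kw; lra.
have [l hl|W hW] := @eventually_bounded (size s) (fun l w => 1 < w ->
  [/\ 1 <= inv_prod s.[l] (Ch w), inv_prod s.[l] A <= inv_prod s.[l] (Ch w)
    & inv_prod s.[l] B <= inv_prod s.[l] (Ch w)]).
  have [->|li] := eqVneq l i.
    by exists 0 => w _ w1; rewrite sA ACh // hAA hAB; split; lra.
  have [->|lj] := eqVneq l j.
    by exists 0 => w _ w1; rewrite sB BCh // hBB hBA; split; lra.
  have /packingP ps' := ps.
  have := ps' l i hl hi li; have := ps' l j hl hj lj; rewrite sA sB => lB lA.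
  have [|W hW] := @quadratic_eventually (inv_prod s.[l] A + inv_prod s.[l] B)
    (curv s.[l] * (center s.[l]).2) (curv s.[l]); first by lra.
  exists W => w /hW h w1; have [_ _ ->] := hCh w w1; split; lra.
(* Both neighbours, w - 2 and w + 2, must stay at least [W], and at least 2 so that their curvature
   is at least that of the unit circles. *)
pose w := Num.max 4 (W + 2).
have [w4 wW] : 4 <= w /\ W + 2 <= w by rewrite !le_max !lexx orbT.
have w1 : 1 < w by lra.
exists (Ch w); split.
  by apply/packing_rcons; split=> // l hl; case: (hW w _ l hl w1); lra.
move=> t pt; set s2 := rcons _ t in pt *.
have sz2 : size s2 = (size s).+2 by rewrite !size_rcons.
have old l : (l < size s)%N -> s2.[l] = s.[l].
  by move=> hl; rewrite !nth_rcons size_rcons (leqW hl) hl.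
have newC : s2.[size s] = Ch w.
  by rewrite !nth_rcons size_rcons ltnSn ltnn eqxx.
have newt : s2.[(size s).+1] = t by rewrite nth_rcons size_rcons ltnn eqxx.
have [_ pt'] := (packing_rcons _ _).1 pt.
rewrite size_rcons in pt'.
have tA : 1 <= inv_prod t A.
  by have := pt' i (leqW hi); rewrite nth_rcons hi sA inv_prodC.
have tB : 1 <= inv_prod t B.
  by have := pt' j (leqW hj); rewrite nth_rcons hj sB inv_prodC.
have tC : 1 <= inv_prod t (Ch w).
  by have := pt' (size s) (ltnSn _); rewrite nth_rcons ltnn eqxx inv_prodC.
(* The two candidates satisfy D + D' = 2 (A + B + C), so [t] blocks at most
   one of them. *)
have [w' [w'W ww' w'2 tD]] : exists w', [/\ W <= w', (w - w') ^+ 2 = 4, 2 <= w' &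
    inv_prod t A + inv_prod t B + inv_prod t (Ch w) <= inv_prod t (Ch w')].
  have [_ _ e0] := hCh w w1.
  have [|_ _ e1] := hCh (w + 2); first by lra.
  have [|_ _ e2] := hCh (w - 2); first by lra.
  have [le|lt] := leP (inv_prod t A + inv_prod t B + inv_prod t (Ch w))
      (inv_prod t (Ch (w + 2))).
    by exists (w + 2); split=> //; lra.
  exists (w - 2); split; try lra.
  by move: lt; rewrite e0 e1 e2; lra.
have w'1 : 1 < w' by lra.
have [kD _ _] := hCh w' w'1.
pose g (v : 'I_3) := nth 0%N [:: i; j; size s] v.
exists 'I_3, (fun x y => x != y), [:: (0, 1, 2%:R); (0, 2%:R, 1)], g, 0, 1, 2%:R, (Ch w').
have g0 : s2.[i] = A by rewrite old.
have g1 : s2.[j] = B by rewrite old.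
have hCA := ACh w w1; have hCB := BCh w w1.
have hAC : inv_prod (Ch w) A = 1 by rewrite inv_prodC.
have hBC : inv_prod (Ch w) B = 1 by rewrite inv_prodC.
split.
- split; last by rewrite inE eqxx.
  split; first exact: card_ord.
  + by apply: drawn_K3; rewrite ?card_ord.
  + move=> [[|[|[|//]]] ?] [[|[|[|//]]] ?] //= E; apply/val_inj => //=;
      by move: hi hj ij; rewrite /g /= in E; rewrite ?E -?E ?ltnn ?eqxx.
  + by move=> [[|[|[|//]]] ?]; rewrite /g /= sz2 // ltnW // ltnS ltnW.
  + by move=> [[|[|[|//]]] ?] [[|[|[|//]]] ?] //= _; rewrite /g /= ?g0 ?g1 ?newC.
- by rewrite g0 g1 newC.
- by rewrite g0 g1 newC; split; rewrite ?ACh ?BCh ?ChCh.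
- by rewrite g0 g1 kD /curv /= invr1; split; nra.
move=> l; rewrite g0 g1 sz2 ltnS leq_eqVlt => /predU1P[->|].
  by rewrite newt; split; lra.
rewrite ltnS leq_eqVlt => /predU1P[->|hl].
  by rewrite newC ChCh // hAC hBC.
by rewrite old //; apply: hW.
Qed.

(** The second unit circle goes on the side of the first away from the center of [t], hence no
    nearer to that center than the first. *)
Lemma second_circle t : 1 <= inv_prod t (unit_circle (0, 0)) ->
  exists eps : R, eps ^+ 2 = 1 /\ 1 <= inv_prod t (unit_circle (2 * eps, 0)).
Proof.
have r0 := radius_gt0 t.
rewrite /inv_prod /sqdist /= ler_pdivlMr ?mulr_gt0 // => h.
have [x0|x0] := leP (center t).1 0; [exists 1|exists (- 1)];
  by split; [ring | rewrite ler_pdivlMr ?mulr_gt0 //; nra].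
Qed.

(** * The invariant of the game *)

(** Half the size counts complete rounds. Builder's first two circles are the tangent unit circles,
    the third completes a triangle, and each later one adds a vertex. *)
Definition invariant s : Prop :=
  match (size s)./2 with
  | 0 => s = [::]
  | 1 => exists i (eps : R), [/\ eps ^+ 2 = 1, (i < size s)%N,
           s.[i] = unit_circle (0, 0) &
           forall l, (l < size s)%N -> 1 <= inv_prod s.[l] (unit_circle (2 * eps, 0))]
  | 2 => exists i j (eps : R), [/\ eps ^+ 2 = 1, (i < size s)%N, (j < size s)%N,
           s.[i] = unit_circle (0, 0) & s.[j] = unit_circle (2 * eps, 0)]
  | j => fillable j s
  end.

Lemma invariant_step s : packing s -> invariant s ->
  exists C, packing (rcons s C) /\
    forall t, packing (rcons (rcons s C) t) -> invariant (rcons (rcons s C) t).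
Proof.
move=> ps; rewrite /invariant.
have szS C t : (size (rcons (rcons s C) t))./2 = (size s)./2.+1.
  by rewrite !size_rcons.
case: (size s)./2 szS => [|[|[|j]]] szS.
- move=> s0; exists (unit_circle (0, 0)); rewrite s0 in szS *; split.
    by apply/packingP => -[|//] [|//].
  move=> t; rewrite szS => /packing_rcons[_ /(_ 0%N isT) /=].
  rewrite inv_prodC => /second_circle [eps [eps2 ht]].
  exists 0%N, eps; split=> // -[|[|//]] _ //=.
  rewrite /inv_prod /sqdist /=.
  have -> : (0 - 2 * eps) ^+ 2 = 4 * eps ^+ 2 by ring.
  by rewrite eps2; lra.
- move=> [i [eps [eps2 hi sA hB]]]; exists (unit_circle (2 * eps, 0)); split.
    exact/packing_rcons.
  move=> t _; rewrite szS; exists i, (size s), eps; split; rewrite // ?size_rcons //.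
  + by rewrite ltnW // ltnS ltnW.
  + by rewrite !nth_rcons size_rcons (leqW hi) hi.
  + by rewrite !nth_rcons size_rcons ltnSn ltnn eqxx.
- move=> [i [j [eps [eps2 hi hj sA sB]]]].
  have [C [pC hC]] := third_circle_step eps2 ps hi hj sA sB.
  by exists C; split=> // t /hC; rewrite szS.
- move=> /(fillable_step ps) [C [pC hC]].
  by exists C; split=> // t /hC; rewrite szS.
Qed.

End Circles.

Theorem theorem1p7 (R : realType) (n : nat) (hn : (3 <= n)%N) :
  exists sigma : seq (circle R) -> circle R,
    builder_strategy sigma /\
    forall x : nat -> circle R, play_following sigma x ->
      exists m : nat, contains_apollonian n (mkseq x m).
Proof.
have [sigma [legal win]] :=
  strategy_of_invariant (erefl : invariant [::]) (@invariant_step R).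
(* After n rounds, that is 2n circles, the network has n vertices. *)
exists sigma; split=> // x /win /(_ n) inv; exists n.*2.
move: inv; rewrite /invariant size_mkseq doubleK.
by case: n hn => [|[|[|n]]] // _ /fillable_contains.
Qed.
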